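(* There exists no $R_t$-type strategy for even integers $t\ge 3$.
   Context: Two-player Levine hat game with infinite stacks: players A and B have stacks $U=(U^{(k)})_{k\ge1}$ and $V=(V^{(k)})_{k\ge1}$, all entries being independent Bernoulli$(1/2)$ variables ($1$ = black, $0$ = white). Each player sees only the other player's stack and names an index in $\{1,2,3,\dots\}$. If A uses the (measurable) strategy $K_1$ and B uses $K_2$, the players win if and only if $U^{(K_1(V))}=1$ and $V^{(K_2(U))}=1$. A $t$-strategy for one player is a function $\{0,1\}^t\to\{1,\dots,t\}$. Let $\mathcal C_t\subset\{0,1\}^t$ be the set of non-monochromatic $t$-tuples, i.e. all $t$-tuples except $(0,\dots,0)$ and $(1,\dots,1)$. Given a $t$-strategy $k$, the associated recursive strategy $K$ is: cut the observed infinite stack into consecutive blocks of $t$ hats, skip the monochromatic blocks, and upon reaching the first non-monochromatic block $u$, after $m\ge0$ skipped blocks, return $mt+k(u)$ (almost surely such a block exists; otherwise the value is arbitrary). For $t\ge3$, an $R_t$-type strategy is a pair $(K_1,K_2)$ of strategies for the two players, where $K_1$ and $K_2$ are the recursive strategies associated in this way with $t$-strategies $k_1$ and $k_2$ (not necessarily equal), such that the probability of victory when A uses $K_1$ and B uses $K_2$ is exactly $7/20$. *)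

(* Defs.v *)
From mathcomp Require Import all_boot all_order all_algebra finmap.
From mathcomp Require Import all_classical all_reals all_analysis.

Set Implicit Arguments.
Unset Strict Implicit.
Unset Printing Implicit Defensive.

Import Order.TTheory GRing.Theory Num.Theory.

Local Open Scope classical_set_scope.
Local Open Scope ring_scope.

(* Positions in a stack are numbered from 0: hat number [i] here is hat number
   [i + 1] in the convention where indices range over {1, 2, 3, ...}.
   [true] is black (1) and [false] is white (0). *)

(* {0,1}^N with its product sigma-algebra. *)
Definition coordinate_sets : set_system (nat -> bool) :=
  \bigcup_i preimage_set_system setT (fun s : nat -> bool => s i) measurable.

Notation stack := (g_sigma_algebraType coordinate_sets).

Definition strategy := {mfun stack >-> nat}.

Definition t_strategy (t : nat) := t.-tuple bool -> 'I_t.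

Definition monochromatic (t : nat) (u : t.-tuple bool) : bool :=
  (u == [tuple of nseq t false]) || (u == [tuple of nseq t true]).

Definition block (t : nat) (s : stack) (m : nat) : t.-tuple bool :=
  [tuple s (m * t + i)%N | i < t].

(* The value of [K] is left unconstrained on the stacks all of whose blocks are
   monochromatic.  As both the positions in a stack and the values of [k] are
   numbered from 0, no shift is needed in [m * t + k u]. *)
Definition recursive_strategy (t : nat) (k : t_strategy t) (K : strategy) :
    Prop :=
  forall (s : stack) (m : nat),
    (forall j, (j < m)%N -> monochromatic (block t s j)) ->
    ~~ monochromatic (block t s m) ->
    K s = (m * t + k (block t s m))%N.

Definition mutually_independent (d d' : measure_display) (T : measurableType d)
    (T' : measurableType d') (R : realType) (P : probability T R)
    (I : choiceType) (X : I -> {RV P >-> T'}) : Prop :=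
  forall (J : {fset I}) (B : I -> set T'),
    (forall i, measurable (B i)) ->
    P (\bigcap_(i in [set` J]) (X i @^-1` B i)) =
    (\prod_(i <- J) P (X i @^-1` B i))%E.

Definition hats (d : measure_display) (T : measurableType d) (R : realType)
    (P : probability T R) (U V : nat -> {RV P >-> bool}) (i : nat + nat) :
    {RV P >-> bool} :=
  match i with inl n => U n | inr n => V n end.

Definition fair_stacks (d : measure_display) (T : measurableType d)
    (R : realType) (P : probability T R) (U V : nat -> {RV P >-> bool}) :
    Prop :=
  mutually_independent (hats U V) /\
  forall (i : nat + nat) (A : set bool),
    distribution P (hats U V i) A = bernoulli_prob (2^-1 : R) A.

Definition observed (d : measure_display) (T : measurableType d)
    (R : realType) (P : probability T R) (U : nat -> {RV P >-> bool}) (w : T) :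
    stack :=
  fun n => U n w.

Definition victory (d : measure_display) (T : measurableType d)
    (R : realType) (P : probability T R) (U V : nat -> {RV P >-> bool})
    (K1 K2 : strategy) : set T :=
  [set w | U (K1 (observed V w)) w = true /\ V (K2 (observed U w)) w = true].

Definition Rt_type (d : measure_display) (T : measurableType d)
    (R : realType) (P : probability T R) (U V : nat -> {RV P >-> bool})
    (t : nat) (K : strategy * strategy) : Prop :=
  [/\ exists k1 : t_strategy t, recursive_strategy k1 K.1,
      exists k2 : t_strategy t, recursive_strategy k2 K.2
    & P (victory U V K.1 K.2) = (7 / 20)%:E].

(* Main.v *)
Require Import Defs.
From mathcomp Require Import all_boot all_order all_algebra finmap.
From mathcomp Require Import all_classical all_reals all_analysis.
From mathcomp Require Import zify ring lra.

(** The obstruction is arithmetic: for even [t], no pair of recursive strategies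
    wins with probability 7/20.

    Let N = 2^t be the number of blocks, 2 of which are monochromatic, and let W
    count the pairs (u, v) of non-monochromatic blocks such that [k1 v] names a
    black hat of u and [k2 u] names a black hat of v.  Look at the first blocks
    (u, v) of the two stacks.  If both are non-monochromatic, the players win
    on W of the N^2 pairs.  If both are monochromatic (4 pairs), the game
    restarts, with the same probability x of victory.  If exactly one of them is
    monochromatic (2 * 2 * (N - 2) pairs), the player who sees it goes on to
    later blocks, where the named hat is black with probability 1/2, while the
    other player names a hat of the monochromatic block, which is black for half
    of these pairs.  Hence
      x N^2 = 4 x + (N - 2) + W,
    which is [victory_probability].  For x = 7/20 this reads
    7 N^2 + 12 = 20 (N + W); but N^2 is a power of 16 when [t] is even, so the
    left side is 4 modulo 5, a contradiction.

    The restart argument is carried out on finite games rather than on the law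
    of the infinite stacks.  Cut both stacks after [n] blocks and declare a
    player who has seen only monochromatic blocks a loser.  Then everything is
    counting, and the numbers of won configurations obey the linear recurrence
    [winsS].  By independence all configurations of [2 n] blocks have the same
    probability ([blocks_law]), and the game is decided by the first [n] blocks
    except on a fraction at most 2 (2 / N)^n of them ([victory_bounds]); letting
    [n] grow turns the recurrence into the equation for x. *)

Set Implicit Arguments.
Unset Strict Implicit.
Unset Printing Implicit Defensive.

Import Order.TTheory GRing.Theory Num.Theory.
Import numFieldNormedType.Exports.

(** * Sums over tuples *)

Lemma sum_tuple_cons (X : finType) n (F : n.+1.-tuple X -> nat) :
  \sum_s F s = \sum_x \sum_(s : n.-tuple X) F [tuple of x :: s].
Proof.
rewrite pair_bigA/=.
rewrite (reindex (fun p : X * n.-tuple X => [tuple of p.1 :: p.2]))//=.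
exists (fun s => (thead s, [tuple of behead s])) => [[x s] _|s _] /=.
  by rewrite theadE; congr pair; exact: val_inj.
by rewrite [RHS]tuple_eta.
Qed.

Lemma sum_tuple2_cons (X : finType) n
    (F : n.+1.-tuple X -> n.+1.-tuple X -> nat) :
  \sum_a \sum_b F a b =
  \sum_x \sum_y \sum_(a : n.-tuple X) \sum_(b : n.-tuple X)
    F [tuple of x :: a] [tuple of y :: b].
Proof.
rewrite sum_tuple_cons; apply: eq_bigr => x _.
rewrite [RHS]exchange_big; apply: eq_bigr => a _.
exact: sum_tuple_cons.
Qed.

Lemma sum_tuple2_const (X : finType) n c :
  \sum_(a : n.-tuple X) \sum_(b : n.-tuple X) c = (#|X| ^ (2 * n) * c)%N.
Proof. by rewrite !sum_nat_const card_tuple mulnA mul2n -addnn expnD. Qed.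

(** * Counting won configurations of finite games *)

Section Counting.
Variable t : nat.
Hypothesis t_gt0 : (0 < t)%N.
Local Notation X := (t.-tuple bool).
Local Notation mono := (@monochromatic t).

(** Colour of the hat that a player following the recursive strategy of [k]
    names on the stack [own], when seeing the stack [seen]; both are given by
    finitely many blocks, and a search that runs out of blocks counts as a
    white hat. *)
Fixpoint named_hat (k : t_strategy t) (seen own : seq X) : bool :=
  match seen, own with
  | v :: seen', u :: own' =>
      if mono v then named_hat k seen' own' else tnth u (k v)
  | _, _ => false
  end.

Lemma named_hat_find k seen own (x0 : X) : size seen = size own ->
  has (predC mono) seen ->
  let m := find (predC mono) seen in
  named_hat k seen own = tnth (nth x0 own m) (k (nth x0 seen m)).
Proof.
elim: seen own => [|v seen IH] [|u own] //= [/IH {}IH].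
by case: (mono v).
Qed.

Lemma named_hat_all_mono k seen own :
  all mono seen -> named_hat k seen own = false.
Proof. by elim: seen own => [|v seen IH] [|u own] //= /andP[-> /IH]. Qed.

Lemma card_blocks : #|{: X}| = (2 ^ t)%N.
Proof. by rewrite card_tuple card_bool. Qed.

Lemma tnth_white i : tnth [tuple of nseq t false] i = false.
Proof. by rewrite (tnth_nth false) nth_nseq if_same. Qed.

Lemma tnth_black i : tnth [tuple of nseq t true] i = true.
Proof. by rewrite (tnth_nth false) nth_nseq ltn_ord. Qed.

Lemma mono_white : mono [tuple of nseq t false].
Proof. by rewrite /monochromatic eqxx. Qed.

Lemma mono_black : mono [tuple of nseq t true].
Proof. by rewrite /monochromatic eqxx orbT. Qed.

Lemma sum_mono (F : X -> nat) :
  \sum_(u | mono u) F u =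
  (F [tuple of nseq t false] + F [tuple of nseq t true])%N.
Proof.
rewrite (bigD1 [tuple of nseq t false])/=; last exact: mono_white.
rewrite (bigD1 [tuple of nseq t true])/= ?big1 ?addn0//.
  by move=> u /andP[/andP[/orP[]/eqP-> ne1 ne2]]; rewrite eqxx in ne1 ne2.
rewrite mono_black/=; apply/eqP => /(congr1 val) /=.
by case: t t_gt0.
Qed.

Lemma card_nonmono : (\sum_(u : X | ~~ mono u) 1 + 2 = 2 ^ t)%N.
Proof.
have card_mono : \sum_(u | mono u) 1 = 2 by rewrite sum_mono.
by rewrite -card_blocks -card_mono addnC -sum1_card [RHS](bigID mono).
Qed.

(** Swapping the two colours exchanges the blocks that have a black hat at [i]
    with those that have a white one. *)
Lemma sum_hat (i : 'I_t) : (2 * \sum_(u : X) tnth u i = 2 ^ t)%N.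
Proof.
pose neg (u : X) : X := [tuple of map negb u].
have negK : involutive neg.
  by move=> u; apply: eq_from_tnth => j; rewrite !tnth_map negbK.
rewrite mul2n -addnn {2}(reindex_inj (inv_inj negK)) -big_split/=.
rewrite -card_blocks -sum1_card; apply: eq_bigr => u _.
by rewrite tnth_map; case: (tnth u i).
Qed.

Lemma sum_all_mono n : \sum_(s : n.-tuple X) all mono s = (2 ^ n)%N.
Proof.
elim: n => [|n IH].
  rewrite (eq_bigr (fun=> 1%N)) => [|s _]; rewrite ?tuple0//.
  by rewrite sum_nat_const card_tuple.
rewrite sum_tuple_cons (bigID mono)/= [X in (_ + X)%N]big1 ?addn0; last first.
  by move=> u /negbTE->; rewrite big1.
by rewrite sum_mono mono_white mono_black/= IH expnS mul2n addnn.
Qed.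

Definition black_hats k n :=
  \sum_(seen : n.-tuple X) \sum_(own : n.-tuple X) named_hat k seen own.

(** The named hat is black in half of the configurations in which the search
    ends; it fails to end for [2 ^ n] of the [(2 ^ t) ^ n] stacks seen. *)
Lemma black_hatsE k n :
  (2 * black_hats k n + (2 * 2 ^ t) ^ n = (2 ^ t) ^ (2 * n))%N.
Proof.
elim: n => [|n IH].
  rewrite muln0 !expn0 /black_hats big1// => a _.
  by rewrite big1// => b _; rewrite tuple0.
have -> : black_hats k n.+1 =
    (\sum_(v : X | mono v) 2 ^ t * black_hats k n +
     \sum_(v : X | ~~ mono v)
       (2 ^ t) ^ (2 * n) * \sum_(u : X) tnth u (k v))%N.
  rewrite /black_hats sum_tuple2_cons (bigID mono)/=.
  congr (_ + _)%N; apply: eq_bigr => v.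
    by move=> ->; rewrite -card_blocks -sum_nat_const; exact: eq_bigr.
  move=> /negbTE->; rewrite big_distrr; apply: eq_bigr => u _.
  by rewrite sum_tuple2_const card_blocks.
rewrite sum_mono mulnDr.
have -> : (2 * \sum_(v | ~~ mono v)
      (2 ^ t) ^ (2 * n) * \sum_(u : X) tnth u (k v) =
    (2 ^ t) ^ (2 * n) * 2 ^ t * \sum_(v | ~~ mono v) 1)%N.
  rewrite !big_distrr/=; apply: eq_bigr => v _.
  by rewrite mulnCA sum_hat muln1.
have := card_nonmono.
set q := \sum_(_ | _) 1%N; set N := (2 ^ t)%N in IH * => qN.
have -> : (2 * n.+1 = (2 * n).+2)%N by lia.
rewrite !expnS -IH; move: (_ ^ n)%N (black_hats k n) => A B.
nia.
Qed.

Definition block_wins (k1 k2 : t_strategy t) :=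
  \sum_(u : X | ~~ mono u) \sum_(v : X | ~~ mono v)
    (tnth u (k1 v) && tnth v (k2 u)).

Definition wins k1 k2 n :=
  \sum_(us : n.-tuple X) \sum_(vs : n.-tuple X)
    (named_hat k1 vs us && named_hat k2 us vs).

(** This is the case analysis on the two first blocks.  In the two mixed cases
    the monochromatic block must be black, and what remains is to count black
    hats in the tails, [2 ^ t - 2] times for each player. *)
Lemma winsS k1 k2 n :
  (wins k1 k2 n.+1 + (2 ^ t - 2) * (2 * 2 ^ t) ^ n =
   4 * wins k1 k2 n +
     (2 ^ t - 2 + block_wins k1 k2) * (2 ^ t) ^ (2 * n))%N.
Proof.
have -> : (2 ^ t - 2)%N = \sum_(u : X | ~~ mono u) 1.
  by rewrite -card_nonmono addnK.
set q := \sum_(_ | _) 1%N.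
suff -> : wins k1 k2 n.+1 = (4 * wins k1 k2 n + q * black_hats k2 n +
    (q * black_hats k1 n + block_wins k1 k2 * (2 ^ t) ^ (2 * n)))%N.
  have B1 := black_hatsE k1 n; have B2 := black_hatsE k2 n.
  by rewrite mulnDl -{1}B1; nia.
pose W := [tuple of nseq t false]; pose B := [tuple of nseq t true].
rewrite {1}/wins sum_tuple2_cons.
pose G (u v : X) := \sum_(us : n.-tuple X) \sum_(vs : n.-tuple X)
  (named_hat k1 (v :: vs) (u :: us) && named_hat k2 (u :: us) (v :: vs)).
rewrite -[LHS]/(\sum_(u : X) \sum_(v : X) G u v).
have Gmm u v : mono u -> mono v -> G u v = wins k1 k2 n.
  by rewrite /G /= => -> ->.
have GW v : ~~ mono v -> (G W v = 0) * (G v W = 0).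
  rewrite /G /= => /negbTE->; rewrite mono_white.
  split; rewrite big1// => us _; rewrite big1// => vs _.
    by rewrite tnth_white.
  by rewrite tnth_white andbF.
have GBr v : ~~ mono v -> G B v = black_hats k2 n.
  rewrite /G /= => /negbTE->; rewrite mono_black.
  by apply: eq_bigr => us _; apply: eq_bigr => vs _; rewrite tnth_black.
have GBl v : ~~ mono v -> G v B = black_hats k1 n.
  rewrite /G /= => /negbTE->; rewrite mono_black exchange_big.
  by apply: eq_bigr => us _; apply: eq_bigr => vs _; rewrite tnth_black andbT.
have Gnn u v : ~~ mono u -> ~~ mono v ->
    G u v = ((tnth u (k1 v) && tnth v (k2 u)) * (2 ^ t) ^ (2 * n))%N.
  rewrite /G /= => /negbTE-> /negbTE->.
  by rewrite sum_tuple2_const card_blocks mulnC.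
rewrite (bigID mono)/=; congr (_ + _)%N.
  under eq_bigr do rewrite (bigID mono)/= sum_mono.
  rewrite sum_mono !Gmm ?mono_white ?mono_black//.
  rewrite (eq_bigr (fun=> 0%N)) => [|v /GW[]//].
  rewrite [X in (_ + (_ + X))%N](eq_bigr (fun=> 1 * black_hats k2 n)%N).
    by rewrite big1// -big_distrl/= -/q; lia.
  by move=> v /GBr->; rewrite mul1n.
rewrite /q /block_wins !big_distrl -big_split/=; apply: eq_bigr => u nu.
rewrite (bigID mono)/= sum_mono GBl// (GW u nu).2 add0n mul1n.
by congr (_ + _)%N; rewrite big_distrl; apply: eq_bigr => v; exact: Gnn.
Qed.

End Counting.

Local Open Scope classical_set_scope.
Local Open Scope ring_scope.

(** * Infinite stacks and their first blocks *)

Definition blocks (t n : nat) (s : stack) : n.-tuple (t.-tuple bool) :=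
  [tuple block t s j | j < n].

(** Hat number [i] of a stack is hat number [i %% t] of block [i %/ t], so
    prescribing [n] blocks is prescribing the first [n * t] hats. *)
Lemma hat_blocksP (t n : nat) (t_gt0 : (0 < t)%N)
    (a : n.-tuple (t.-tuple bool)) :
  {al : nat -> bool | forall s : stack,
    blocks t n s = a <-> forall i, (i < n * t)%N -> s i = al i}.
Proof.
exists (fun i =>
  nth false (nth [tuple of nseq t false] a (i %/ t)) (i %% t)) => s; split.
  move=> <- i ilt; have jn : (i %/ t < n)%N by rewrite ltn_divLR.
  rewrite -(tnth_nth _ _ (Ordinal jn)) tnth_mktuple.
  have rt : (i %% t < t)%N by rewrite ltn_mod.
  by rewrite -(tnth_nth _ _ (Ordinal rt)) tnth_mktuple/= -divn_eq.
move=> h; apply: eq_from_tnth => j; rewrite tnth_mktuple.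
apply: eq_from_tnth => r; rewrite tnth_mktuple h; last first.
  rewrite (leq_trans (n := j.+1 * t))// ?leq_mul2r ?ltn_ord ?orbT//.
  by rewrite mulSn addnC ltn_add2r.
by rewrite divnMDl// divn_small// addn0 modnMDl modn_small// -!tnth_nth.
Qed.

(** Once the search has ended, the value of the strategy is forced, whatever
    it is on stacks with monochromatic blocks only. *)
Lemma recursive_hat t (k : t_strategy t) (K : strategy) n (s r : stack) :
  recursive_strategy k K ->
  ~~ all (@monochromatic t) (blocks t n s) ->
  r (K s) = named_hat k (blocks t n s) (blocks t n r).
Proof.
rewrite -has_predC => rK hs.
have x0 : t.-tuple bool := [tuple of nseq t false].
rewrite (named_hat_find k x0 _ hs) ?size_tuple//=.
have := nth_find x0 hs.
have := @before_find _ x0 (predC (@monochromatic t)) (blocks t n s).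
move: hs; rewrite has_find size_tuple.
set m := find _ _ => mn bef nm.
have nthb (s' : stack) j : (j < n)%N -> nth x0 (blocks t n s') j = block t s' j.
  by move=> jn; rewrite -(tnth_nth _ _ (Ordinal jn)) tnth_mktuple.
rewrite /= !nthb// in nm *.
rewrite (rK s m) ?tnth_mktuple// => j jm.
by have := bef j jm; rewrite /= nthb ?(ltn_trans jm)// => /negbFE.
Qed.

(** * The law of the first blocks *)

Section Law.
Context (d : measure_display) (T : measurableType d) (R : realType)
    (P : probability T R) (U V : nat -> {RV P >-> bool}).

Section Fair.
Hypothesis hUV : fair_stacks U V.

Lemma fair_hat i b : P (hats U V i @^-1` [set b]) = (2^-1)%:E.
Proof.
have := hUV.2 i [set b]; rewrite /distribution /pushforward => ->.
rewrite /bernoulli_prob ifT; last by lra.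
by rewrite fsbig_set1 /bernoulli_pmf; case: b => //; congr _%:E; lra.
Qed.

Lemma measurable_hat i b : measurable (hats U V i @^-1` [set b]).
Proof. by rewrite -[X in measurable X]setTI; apply: measurable_funP. Qed.

(** The event is put in the form to which mutual independence applies. *)
Lemma prefix_bigcap m (al be : nat -> bool) :
  exists J : {fset nat + nat}, #|` J|%fset = (m + m)%N /\
  [set w | (forall i, (i < m)%N -> U i w = al i) /\
           (forall i, (i < m)%N -> V i w = be i)] =
  \bigcap_(i in [set` J]) (hats U V i @^-1`
    [set match i with inl i => al i | inr i => be i end]).
Proof.
pose s : seq (nat + nat) :=
  [seq inl i | i <- iota 0 m] ++ [seq inr i | i <- iota 0 m].
have [J [memJ sJ]] : exists J : {fset nat + nat},
    J =i s /\ #|` J|%fset = size (undup s).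
  by exists (seq_fset tt s); split; [exact: seq_fsetE | exact: size_seq_fset].
exists J; split.
  rewrite sJ undup_id ?size_cat ?size_map ?size_iota//.
  rewrite cat_uniq !map_inj_uniq ?iota_uniq/=; try by move=> ? ? [].
  by rewrite andbT; apply/hasPn => _ /mapP[i _ ->]; apply/negP => /mapP[].
apply/seteqP; split => w /=.
  move=> [hU hV] i /=; rewrite memJ mem_cat => /orP[] /mapP[j];
    rewrite mem_iota => /= jm ->; [exact: hU|exact: hV].
move=> h; split => i im.
  by apply: (h (inl i)) => /=; rewrite memJ mem_cat map_f// mem_iota.
by apply: (h (inr i)) => /=; rewrite memJ mem_cat (map_f inr) ?orbT// mem_iota.
Qed.

Lemma prefix_law m (al be : nat -> bool) :
  let E := [set w | (forall i, (i < m)%N -> U i w = al i) /\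
                    (forall i, (i < m)%N -> V i w = be i)] in
  measurable E /\ P E = ((2 ^+ (m + m))^-1)%:E.
Proof.
have [J [sJ ->]] := prefix_bigcap m al be; split.
  by apply: fin_bigcap_measurable => // i _; exact: measurable_hat.
rewrite hUV.1//; under eq_bigr do rewrite fair_hat.
by rewrite prodEFin big_const_seq count_predT sJ iter_mulr_1 exprVn.
Qed.

Variable t : nat.
Hypothesis t_gt0 : (0 < t)%N.
Variable n : nat.
Local Notation Bs := (n.-tuple (t.-tuple bool)).

Lemma blocks_law (a b : Bs) :
  let E := [set w | blocks t n (observed U w) = a /\
                    blocks t n (observed V w) = b] in
  measurable E /\ P E = (((2 ^ t) ^ (2 * n))%N%:R^-1)%:E.
Proof.
have [al hal] := hat_blocksP t_gt0 a; have [be hbe] := hat_blocksP t_gt0 b.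
have [mE PE] := prefix_law (n * t) al be.
set E := (X in let _ := X in _); rewrite /=.
have -> : E = [set w | (forall i, (i < n * t)%N -> U i w = al i) /\
                       (forall i, (i < n * t)%N -> V i w = be i)].
  by apply/seteqP; split => w; rewrite /E/= hal hbe.
split=> //; rewrite PE; congr (_^-1)%:E.
by rewrite !natrX -exprM; congr (_ ^+ _); lia.
Qed.

(** An event that depends on the first blocks only is a finite disjoint union
    of events of the same probability, so its probability is a proportion. *)
Lemma blocks_event_law (f : Bs -> Bs -> bool) :
  let E := [set w | f (blocks t n (observed U w))
                      (blocks t n (observed V w))] in
  measurable E /\
  P E = ((\sum_a \sum_b f a b)%N%:R / ((2 ^ t) ^ (2 * n))%N%:R)%:E.
Proof.
pose F (ab : Bs * Bs) := [set w | blocks t n (observed U w) = ab.1 /\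
                                  blocks t n (observed V w) = ab.2].
have mF ab : measurable (F ab) by exact: (blocks_law ab.1 ab.2).1.
set E := (X in let _ := X in _); rewrite /=.
have -> : E = \bigcup_(ab in [set ab | f ab.1 ab.2]) F ab.
  apply/seteqP; split => w; rewrite /E/=.
    by exists (blocks t n (observed U w), blocks t n (observed V w)).
  by move=> [[a b] /= fab [-> ->]].
have [J memJ sJ] : exists2 J : {fset Bs * Bs},
    forall ab, (ab \in J) = f ab.1 ab.2 &
    #|` J|%fset = (\sum_a \sum_b f a b)%N.
  exists (seq_fset tt [seq ab <- enum {: Bs * Bs} | f ab.1 ab.2]) => [ab|].
    by rewrite seq_fsetE mem_filter mem_enum andbT.
  rewrite size_seq_fset undup_id; last by apply: filter_uniq; exact: enum_uniq.
  rewrite size_filter pair_bigA /= -sum1_count big_enum_cond/= big_mkcond/=.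
  by apply: eq_bigr => ab _; case: (f _ _).
have -> : [set ab | f ab.1 ab.2] = [set` J].
  by apply/seteqP; split => ab /=; rewrite memJ.
split; first exact: fin_bigcup_measurable.
rewrite bigcup_fset measure_fbigsetU//; last first.
  by move=> [a b] [a' b'] _ _ [w [[/= <- <-] [/= <- <-]]].
rewrite (eq_bigr (fun=> (((2 ^ t) ^ (2 * n))%N%:R^-1)%:E)) => [|ab _].
  by rewrite sumEFin big_const_seq count_predT sJ iter_addr_0 mulr_natl.
exact: (blocks_law _ _).2.
Qed.

End Fair.

Lemma measurable_observed (W : nat -> {RV P >-> bool}) :
  measurable_fun setT (observed W : T -> stack).
Proof.
apply: (@measurability _ _ T stack setT (observed W) coordinate_sets erefl).
move=> _ [_ [i _ [B mB <-]] <-].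
rewrite !setTI -[X in measurable X]setTI.
exact: (measurable_funPT (W i)).
Qed.

(** The index of the hat is itself random: split along its value. *)
Lemma measurable_named_hat (W W' : nat -> {RV P >-> bool}) (K : strategy) :
  measurable [set w | W (K (observed W' w)) w = true].
Proof.
have -> : [set w | W (K (observed W' w)) w = true] =
    \bigcup_i ([set w | K (observed W' w) = i] `&` (W i @^-1` [set true])).
  apply/seteqP; split => w /=; first by move=> h; exists (K (observed W' w)).
  by move=> [i _ [/= -> ]].
apply: bigcup_measurable => i _; apply: measurableI.
  have mK : measurable_fun setT (K \o (observed W' : T -> stack)).
    apply: measurableT_comp; first exact: measurable_funPT.
    exact: measurable_observed.
  by rewrite -[X in measurable X]setTI; exact: (mK measurableT [set i]).
by rewrite -[X in measurable X]setTI; exact: (measurable_funPT (W i)).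
Qed.

Lemma measurable_victory (K1 K2 : strategy) : measurable (victory U V K1 K2).
Proof.
exact: measurableI (measurable_named_hat U V K1) (measurable_named_hat V U K2).
Qed.

End Law.

(** * The probability of victory *)

Lemma geometric_dominated0 (R : archiRealFieldType) (z C q : R) :
  0 <= q < 1 -> (forall n, `|z| <= C * q ^+ n) -> z = 0.
Proof.
move=> /andP[q0 q1] h; apply/eqP; rewrite -normr_le0.
have q1' : `|q| < 1 by rewrite ger0_norm.
apply: (ler_cvg_to (f := fun=> `|z|) (cvg_cst _) (cvg_geometric C q1')).
by apply: nearW => n; exact: h.
Qed.

Section Victory.
Context (d : measure_display) (T : measurableType d) (R : realType)
    (P : probability T R) (U V : nat -> {RV P >-> bool}).
Hypothesis hUV : fair_stacks U V.
Variables (t : nat) (k1 k2 : t_strategy t) (K1 K2 : strategy).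
Hypotheses (rK1 : recursive_strategy k1 K1) (rK2 : recursive_strategy k2 K2).

(** Victory in the game cut after [n] blocks implies victory, and victory
    implies it unless one of the players sees monochromatic blocks only, which
    happens in at most [2 * (2 * 2 ^ t) ^ n] configurations. *)
Lemma victory_bounds (t_gt0 : (0 < t)%N) (x : R) n :
  P (victory U V K1 K2) = x%:E ->
  (wins k1 k2 n)%:R <= x * ((2 ^ t) ^ (2 * n))%:R
    <= (wins k1 k2 n + 2 * (2 * 2 ^ t) ^ n)%:R.
Proof.
move=> Px.
pose won (us vs : n.-tuple (t.-tuple bool)) :=
  named_hat k1 vs us && named_hat k2 us vs.
pose undecided (us vs : n.-tuple (t.-tuple bool)) :=
  all (@monochromatic t) us || all (@monochromatic t) vs.
have [mW PW] := blocks_event_law hUV t_gt0 won.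
have [mX PX] := blocks_event_law hUV t_gt0 undecided.
set W := [set w | won _ _] in mW PW.
set X := [set w | undecided _ _] in mX PX.
set D := ((2 ^ t) ^ (2 * n))%:R in PW PX *.
have D0 : 0 < D :> R by rewrite ltr0n !expn_gt0.
have notmono k (vs us : n.-tuple (t.-tuple bool)) :
    named_hat k vs us -> ~~ all (@monochromatic t) vs.
  by apply: contraL => /named_hat_all_mono->.
have WV : W `<=` victory U V K1 K2.
  move=> w /andP[h1 h2]; split.
    exact: etrans (recursive_hat (observed U w) rK1 (notmono _ _ _ h1)) h1.
  exact: etrans (recursive_hat (observed V w) rK2 (notmono _ _ _ h2)) h2.
have VWX : victory U V K1 K2 `<=` W `|` X.
  move=> w [/= h1 h2].
  have [?|] := boolP (undecided (blocks t n (observed U w))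
                                (blocks t n (observed V w))); [by right|].
  rewrite negb_or => /andP[nu nv]; left; apply/andP; split.
    exact: etrans (esym (recursive_hat (observed U w) rK1 nv)) h1.
  exact: etrans (esym (recursive_hat (observed V w) rK2 nu)) h2.
have cX : (\sum_us \sum_vs undecided us vs <= 2 * (2 * 2 ^ t) ^ n)%N.
  apply: (@leq_trans (\sum_(us : n.-tuple (t.-tuple bool))
      \sum_(vs : n.-tuple (t.-tuple bool))
      (all (@monochromatic t) us + all (@monochromatic t) vs))%N).
    apply: leq_sum => us _; apply: leq_sum => vs _.
    by rewrite /undecided; do 2 case: (all _ _).
  under eq_bigr do rewrite big_split/= sum_nat_const sum_all_mono//.
  rewrite big_split/= sum_nat_const -big_distrr/= sum_all_mono//.
  by rewrite card_tuple card_blocks expnMn mulnC addnn mul2n.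
have xW : (P W <= P (victory U V K1 K2))%E.
  by apply: le_measure; rewrite ?inE//; exact: measurable_victory.
have xWX : (P (victory U V K1 K2) <= P W + P X)%E.
  apply: le_trans (measureU2 _ mW mX).
  apply: le_measure; rewrite ?inE//; first exact: measurable_victory.
  exact: measurableU.
move: xW xWX; rewrite PW PX Px -EFinD !lee_fin -mulrDl.
rewrite ler_pdivrMr// ler_pdivlMr// => -> /le_trans; apply.
by rewrite natrD lerD2l ler_nat.
Qed.

(** Put the bounds on x for [n] and [n + 1] into [winsS]: the two sides of the
    equation differ by O((2 N)^n) once multiplied by N^(2 n), where N = 2^t,
    hence by O((2 / N)^n), and N > 2. *)
Lemma victory_probability (t_gt1 : (1 < t)%N) (x : R) :
  P (victory U V K1 K2) = x%:E ->
  x * ((2 ^ t) ^ 2)%:R = 4 * x + (2 ^ t - 2 + block_wins k1 k2)%:R.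
Proof.
have t_gt0 := ltnW t_gt1.
move=> /(victory_bounds t_gt0) bounds; apply/eqP; rewrite -subr_eq0; apply/eqP.
have N4 : (4 <= 2 ^ t)%N by rewrite (leq_pexp2l (m := 2) (n1 := 2)).
pose N : R := (2 ^ t)%:R; pose M : R := (2 ^ t - 2)%:R.
have N4R : 4 <= N by rewrite ler_nat.
(* With A n := x N^(2 n) - wins n, which lies between 0 and 2 (2 N)^n, the
   difference z of the two sides satisfies
   z N^(2 n) = A (n + 1) - 4 A n - M (2 N)^n; its three terms are bounded by
   4 N, 8 and M times (2 N)^n. *)
apply: (@geometric_dominated0 _ _ (4 * N + 8 + M) (2 / N)).
  by rewrite divr_ge0 ?ltr_pdivrMr ?mul1r; lra.
move=> n; set z := (X in `|X|).
have D0 : 0 < N ^+ n * N ^+ n by rewrite mulr_gt0// exprn_gt0; lra.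
have -> : (4 * N + 8 + M) * (2 / N) ^+ n =
    (4 * N + 8 + M) * (2 ^+ n * N ^+ n) / (N ^+ n * N ^+ n).
  by rewrite expr_div_n; field; rewrite expf_neq0//; lra.
rewrite ler_pdivlMr// -[N ^+ n * N ^+ n in X in X <= _](gtr0_norm D0) -normrM.
have := bounds n.+1; have := bounds n; clear bounds.
have := congr1 (fun k => k%:R : R) (winsS t_gt0 k1 k2 n).
rewrite /z.
rewrite !(natrD, natrM, natrX, mul2n, =^~ addnn, exprD, exprMn, exprS, expr0).
rewrite -/M; have <- : N = 2 ^+ t by rewrite /N natrX.
have ab0 : 0 <= 2 ^+ n * N ^+ n by rewrite mulr_ge0 ?exprn_ge0//; lra.
have Mab0 : 0 <= M * (2 ^+ n * N ^+ n) by rewrite mulr_ge0 ?ler0n.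
have Nab0 : 0 <= N * (2 ^+ n * N ^+ n) by rewrite mulr_ge0//; lra.
clearbody M.
move: (wins k1 k2 n)%:R (wins k1 k2 n.+1)%:R (block_wins k1 k2)%:R
  (2 ^+ n) (N ^+ n) ab0 Mab0 Nab0 {z D0} => w w' W a b ab0 Mab0 Nab0.
move=> rec /andP[l1 u1] /andP[l2 u2].
by rewrite ler_norml; apply/andP; split; lra.
Qed.

End Victory.

(** * Even block lengths *)

Theorem theorem22 (d : measure_display) (T : measurableType d) (R : realType)
    (P : probability T R) (U V : nat -> {RV P >-> bool})
    (hUV : fair_stacks U V) (t : nat) (ht : (3 <= t)%N) (t_even : ~~ odd t) :
  ~ exists K : strategy * strategy, Rt_type U V t K.
Proof.
case=> K [[k1 rK1] [k2 rK2] PK].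
have := victory_probability hUV rK1 rK2 (ltnW ht) PK.
have N2 : (2 <= 2 ^ t)%N by rewrite -{1}(expn1 2) leq_exp2l//; lia.
move: (block_wins k1 k2) => W; rewrite natrD natrB// => E.
have {}E : (7 * (2 ^ t) ^ 2 + 12 = 20 * (2 ^ t + W))%N.
  clear PK; apply/eqP; rewrite -(eqr_nat R) !(natrD, natrM).
  by apply/eqP; lra.
have N16 : ((2 ^ t) ^ 2 = 1 %[mod 5])%N.
  rewrite -expnM -(even_halfK t_even) -muln2 -mulnA mulnC expnM.
  by rewrite -modnXm exp1n.
lia.
Qed.
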